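(* Let $\gamma>0$ and $\Psi_\gamma(x)=(1-x^{-\gamma})\mathbb{1}_{[1,\infty)}(x)$. Let $(\mathcal{M},\tau)$ be a tracial $W^*$-probability space, let $\{X_i\}_{i\ge 1}$ be freely independent self-adjoint operators affiliated with $\mathcal{M}$, all having the same spectral distribution function $U$, and let $a_n>0$, $b_n\in\mathbb{R}$ be such that the spectral distribution functions $F_{W_n}$ of $$W_n=\frac{X_1\lor\cdots\lor X_n-b_n}{a_n}$$ converge weakly to $\Psi_\gamma$ as $n\to\infty$. Assume that for each $n\ge 2$ the random variable $W_n$ has a density $u_n$ with respect to Lebesgue measure on $\mathbb{R}$ such that, with $\rho_n:=(\log u_n)'$: (i) $\mathrm{supp}(u_n)=[A_n,B_n]$ for some $0<A_n<B_n\le\infty$ (with $[A_n,B_n]=[A_n,\infty)$ if $B_n=\infty$); (ii) $\lim_{t\to A_n+0}t\,u_n(t)$ exists in $[0,\infty)$ and $\lim_{t\to B_n-0}t\,u_n(t)=0$; (iii) $u_n$ is differentiable on $(A_n,B_n)$; (iv) $t\mapsto t\rho_n(t)$ is bounded and continuous on $(A_n,B_n)$. Then for each $n\ge 2$, $$d_K(F_{W_n},\Psi_\gamma)\le \tau\big(|1+\gamma^{-1}(1+W_n\rho_n(W_n))|\big)+\gamma^{-1}A_n\big\{1-(A_n\wedge A_n^{-1})^{\gamma}\big\}u_n(A_n+).$$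
   Context: A tracial $W^*$-probability space $(\mathcal{M},\tau)$ is a von Neumann algebra $\mathcal{M}$ (acting on a Hilbert space $\mathcal H$) with a tracial normal faithful state $\tau$. A (possibly unbounded) self-adjoint operator $X$ is affiliated with $\mathcal{M}$ if $f(X)\in\mathcal{M}$ for every bounded Borel function $f$ on $\mathbb{R}$; such operators are called random variables. The spectral distribution function of $X$ is $F_X(x)=\tau(\mathbb{1}_{(-\infty,x]}(X))$, $x\in\mathbb{R}$, where $\mathbb{1}_B$ is the indicator function of $B$. For projections $P,Q\in\mathcal{M}$, $P\lor Q$ is the projection onto the closure of $P\mathcal{H}+Q\mathcal{H}$. For self-adjoint $X,Y$ affiliated with $\mathcal{M}$, the spectral maximum $X\lor Y$ is the self-adjoint operator affiliated with $\mathcal{M}$ determined by $\mathbb{1}_{(x,\infty)}(X\lor Y)=\mathbb{1}_{(x,\infty)}(X)\lor\mathbb{1}_{(x,\infty)}(Y)$ for all $x\in\mathbb{R}$. For freely independent $X,Y$ one has $F_{X\lor Y}=\max\{F_X+F_Y-1,0\}$ (Ben Arous–Voiculescu); hence $F_{W_n}(x)=\max\{nU(a_nx+b_n)-(n-1),0\}$. ''$W_n$ has density $u_n$'' means $\tau(f(W_n))=\int_{\mathbb{R}}f(x)u_n(x)\,dx$ for all bounded Borel functions $f$; $\mathrm{supp}(u_n)=\overline{\{x:u_n(x)>0\}}$; $u_n(A_n+)=\lim_{t\to A_n+0}u_n(t)$; $a\wedge b=\min\{a,b\}$. Since $\rho_n$ is defined on $(A_n,B_n)$, where the distribution of $W_n$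 is concentrated, $\tau(|1+\gamma^{-1}(1+W_n\rho_n(W_n))|)=\int_{A_n}^{B_n}|1+\gamma^{-1}(1+x\rho_n(x))|u_n(x)\,dx$. The Kolmogorov distance between distribution functions $F_1,F_2$ on $\mathbb{R}$ is $d_K(F_1,F_2)=\sup_{x\in\mathbb{R}}|F_1(x)-F_2(x)|$. *)

(* Defs.v *)
From HB Require Import structures.
From mathcomp Require Export all_boot all_order all_algebra.
From mathcomp Require Export complex.
From mathcomp Require Export all_classical all_reals all_analysis.
Export Order.TTheory GRing.Theory Num.Theory.
Export numFieldNormedType.Exports.

#[export] Set Implicit Arguments.
#[export] Unset Strict Implicit.
#[export] Unset Printing Implicit Defensive.

Local Open Scope classical_set_scope.
Local Open Scope complex_scope.
Local Open Scope ring_scope.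

(* Bounded operators are plain functions [H -> H] satisfying
   [bounded_operator]; possibly unbounded operators are graphs,
   [set (H * H)]. *)

Section hilbert.
Context {R : realType} {H : completeNormedModType R[i]}.
Variable ip : {dot H for (@Num.conj R[i])}.

(* The inner product induces the (complete) norm of [H], that is, [H] is a
   Hilbert space. *)
Definition hilbert_space : Prop := forall x : H, `|x| ^+ 2 = ip x x.

Definition bounded_operator (T : H -> H) : Prop := linear T /\ continuous T.

Definition is_adjoint (T S : H -> H) : Prop :=
  forall x y, ip (T x) y = ip x (S y).

Definition is_projection (P : H -> H) : Prop :=
  [/\ bounded_operator P, is_adjoint P P & P \o P = P].

(* The Loewner order; used for self-adjoint operators only. *)
Definition op_le (S T : H -> H) : Prop := forall x, ip (S x) x <= ip (T x) x.

Definition commutant (M : set (H -> H)) : set (H -> H) :=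
  [set T | bounded_operator T /\ forall S, M S -> S \o T = T \o S].

(* The adjoint of a bounded operator exists by Riesz' theorem. *)
Definition von_neumann_algebra (M : set (H -> H)) : Prop :=
  [/\ M `<=` bounded_operator,
      (forall T S, M T -> is_adjoint T S -> M S)
    & commutant (commutant M) = M].

Section state.
Variables (M : set (H -> H)) (tau : (H -> H) -> R[i]).

Definition state : Prop :=
  [/\ (forall (c : R[i]) S T, M S -> M T ->
         tau (fun x => c *: S x + T x) = c * tau S + tau T),
      (forall T S, M T -> is_adjoint T S -> 0 <= tau (S \o T))
    & tau idfun = 1].

Definition tracial : Prop :=
  forall S T, M S -> M T -> tau (S \o T) = tau (T \o S).

Definition faithful : Prop :=
  forall T S, M T -> is_adjoint T S -> tau (S \o T) = 0 -> forall x, T x = 0.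

Definition self_adjoint_part : set (H -> H) := [set T | M T /\ is_adjoint T T].

Definition is_op_sup (D : set (H -> H)) (T : H -> H) : Prop :=
  [/\ self_adjoint_part T,
      (forall S, D S -> op_le S T)
    & (forall T', self_adjoint_part T' ->
         (forall S, D S -> op_le S T') -> op_le T T')].

(* tau preserves suprema of bounded upward directed sets of self-adjoint
   elements *)
Definition normal : Prop :=
  forall (D : set (H -> H)) T,
    D !=set0 -> D `<=` self_adjoint_part ->
    (forall S1 S2, D S1 -> D S2 ->
       exists2 S, D S & op_le S1 S /\ op_le S2 S) ->
    is_op_sup D T ->
    complex.Re (tau T) = sup [set complex.Re (tau S) | S in D].

Definition tracial_Wstar_probability_space : Prop :=
  von_neumann_algebra M /\ [/\ state, tracial, normal & faithful].

End state.

Definition adjoint_graph (X : set (H * H)) : set (H * H) :=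
  [set p | forall q, X q -> ip q.2 p.1 = ip q.1 p.2].

(* Density of the domain makes the adjoint single-valued, and an adjoint is
   always linear and closed. *)
Definition self_adjoint (X : set (H * H)) : Prop :=
  dense (fst @` X) /\ adjoint_graph X = X.

(* A projection-valued measure [E] on the Borel sets of the line, bundled with
   its scalar measures mu_xi(B) = <E(B) xi, xi>. *)
Record projection_valued_measure := ProjectionValuedMeasure {
  pvm :> set R -> H -> H ;
  pvm_scalar : H -> {measure set (measurableTypeR R) -> \bar R} ;
  pvm_projection : forall B, measurable B -> is_projection (pvm B) ;
  pvmT : pvm setT = idfun ;
  pvm_scalarE : forall xi B, measurable B ->
    pvm_scalar xi B = (complex.Re (ip (pvm B xi) xi))%:E }.

(* X = \int x dE(x): by polarization X is determined by its domain and its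
   quadratic form. *)
Definition spectral_measure_of (X : set (H * H))
    (E : projection_valued_measure) : Prop :=
  fst @` X =
    [set xi | (\int[pvm_scalar E xi]_x (x ^+ 2)%:E < +oo)%E] /\
  forall xi eta, X (xi, eta) ->
    ip eta xi = (\int[pvm_scalar E xi]_x x)%R%:C.

Definition bounded_borel (f : R -> R) : Prop :=
  measurable_fun setT f /\ exists K, forall x, `|f x| <= K.

(* f(X) = \int f dE, where E is the spectral measure of X, which exists and is
   unique for self-adjoint X by the spectral theorem; meaningful for bounded
   Borel f. *)
Definition fcalc (X : set (H * H)) (f : R -> R) : H -> H :=
  get [set T | bounded_operator T /\
    exists2 E : projection_valued_measure, spectral_measure_of X E &
      forall xi, ip (T xi) xi = (\int[pvm_scalar E xi]_x f x)%R%:C].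

Definition spectral_projection (X : set (H * H)) (B : set R) : H -> H :=
  fcalc X \1_B.

Definition affiliated (M : set (H -> H)) (X : set (H * H)) : Prop :=
  self_adjoint X /\ forall f, bounded_borel f -> M (fcalc X f).

Definition spectral_df (tau : (H -> H) -> R[i]) (X : set (H * H)) (x : R) : R :=
  complex.Re (tau (spectral_projection X `]-oo, x])).

(* The von Neumann algebra generated by the bounded Borel functions of X. *)
Definition generated_algebra (X : set (H * H)) : set (H -> H) :=
  commutant (commutant [set T | exists2 f, bounded_borel f & T = fcalc X f]).

(* [\big[comp/idfun]_(j < k) T j] is the product T_0 T_1 ... T_(k-1). *)
Definition freely_independent (tau : (H -> H) -> R[i])
    (X : nat -> set (H * H)) : Prop :=
  forall (k : nat) (i : nat -> nat) (T : nat -> H -> H),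
    (0 < k)%N ->
    (forall j, (j < k)%N ->
       generated_algebra (X (i j)) (T j) /\ tau (T j) = 0) ->
    (forall j, (j.+1 < k)%N -> i j != i j.+1) ->
    tau (\big[comp/idfun]_(j < k) T j) = 0.

Definition proj_join (P Q : H -> H) : H -> H :=
  get [set S | is_projection S /\
    range S = closure [set x + y | x in range P & y in range Q]].

Definition spectral_max (M : set (H -> H)) (X Y : set (H * H)) : set (H * H) :=
  get [set Z | affiliated M Z /\ forall x : R,
    spectral_projection Z `]x, +oo[ =
    proj_join (spectral_projection X `]x, +oo[)
              (spectral_projection Y `]x, +oo[)].

(* X_0 \/ ... \/ X_k *)
Fixpoint spectral_maxn (M : set (H -> H)) (X : nat -> set (H * H)) (k : nat)
    : set (H * H) :=
  if k is k'.+1 then spectral_max M (spectral_maxn M X k') (X k) else X 0%N.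

(* (X - b) / a *)
Definition op_normalize (X : set (H * H)) (a b : R) : set (H * H) :=
  [set (p.1, (a^-1)%:C *: (p.2 - b%:C *: p.1)) | p in X].

(* The sequence X_1, X_2, ... is indexed from 0, so that the maximum of the
   first n >= 1 terms is X_0 \/ ... \/ X_(n-1). *)
Definition normalized_max (M : set (H -> H)) (X : nat -> set (H * H))
    (a b : nat -> R) (n : nat) : set (H * H) :=
  op_normalize (spectral_maxn M X n.-1) (a n) (b n).

(* u is a (probability) density of the distribution of W under tau. *)
Definition has_density (tau : (H -> H) -> R[i]) (W : set (H * H)) (u : R -> R)
    : Prop :=
  [/\ measurable_fun setT u, (forall x, 0 <= u x),
      (\int[lebesgue_measure]_x (u x)%:E = 1)%E
    & forall f, bounded_borel f ->
        tau (fcalc W f) = (\int[lebesgue_measure]_x (f x * u x))%R%:C].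

End hilbert.

Section real.
Context {R : realType}.
Implicit Types (F G u : R -> R) (A : R) (B : \bar R).

Definition weakly_converges (F : nat -> R -> R) G : Prop :=
  forall x, {for x, continuous G} -> F n x @[n --> \oo] --> G x.

Definition kolmogorov_dist F G : \bar R :=
  ereal_sup (range (fun x => `|F x - G x|%:E)).

Definition Psi (gamma : R) (x : R) : R :=
  (1 - x `^ (- gamma)) * \1_(`[1, +oo[ : set R) x.

Definition supp u : set R := closure [set x | 0 < u x].

Definition eopen_itv A B : set R := [set x | A < x /\ (x%:E < B)%E].

(* [A, B], or [A, +oo) if B = +oo *)
Definition eclosed_itv A B : set R := [set x | A <= x /\ (x%:E <= B)%E].

(* The filter t --> B - 0, with B possibly +oo; B = -oo has no left
   neighbourhood. *)
Definition eat_left B : set_system R :=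
  match B with
  | b%:E => b^'-
  | +oo%E => pinfty_nbhs R
  | -oo%E => globally set0
  end.

Definition score u : R -> R := derive1 (fun t => ln (u t)).

(* x |-> |1 + gamma^-1 (1 + x rho(x))|, extended by 0 outside (A, B), where
   rho need not be defined. *)
Definition stein_discrepancy (gamma : R) u A B : R -> R :=
  (fun x => `|1 + gamma^-1 * (1 + x * score u x)|) \_ (eopen_itv A B).

End real.

(* Main.v *)
Require Import Defs.
From mathcomp Require Import measurable_realfun ring lra.

(** Write [u] for the density of the normalized maximum [W], [F] for its
    distribution function, [G = 1 - F], and [T t = t * u t].  The traces of
    bounded Borel functions of [W] are integrals against [u], so both sides of
    the inequality are expressed through [u], and the estimate is one about a
    probability density supported by the interval from [A] to [B].

    The Stein discrepancy is the one of the Pareto law: inside the support its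
    product with [u] is the absolute value of the drift
    [D = u + gamma^-1 * T'], which vanishes for the Pareto density.  The Stein
    potential [V = G - gamma^-1 * T] satisfies [V' = - D], hence it oscillates
    by at most [delta], the integral of [`|D|].  It tends to 0 at [B], because
    [T] does, and to [1 - c] at [A], where
    [c = gamma^-1 * T (A+) = gamma^-1 * A * u (A+)].  Therefore [V] is within
    [delta] of both 0 and [1 - c], and [`|1 - c| <= delta]
    ([stein_potential_le], [stein_potential_centered_le],
    [stein_potential_start_le]).

    As [G' = - u], the derivative of [x `^ gamma * G x] is
    [gamma * x `^ (gamma - 1) * V x].  For [k = 0] and for [k = 1 - c],
    comparing it with [delta * x `^ gamma] gives
    [`|x `^ gamma * G x - y `^ gamma * G y - k * (x `^ gamma - y `^ gamma)|
      <= delta * (x `^ gamma - y `^ gamma)] for [y <= x] in the support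
    ([weighted_survival_dist]), also with [y = A] and [G A = 1]
    ([weighted_survival_distA]).  The Pareto survival function is
    [x `^ (- gamma)] to the right of 1 and 1 to the left of 1.  The estimate
    with [k = 0] handles [1 <= A]; if [A < 1], the one with [k = 1 - c] is used
    up to the point 1 and the one with [k = 0] beyond it.  Dividing by
    [x `^ gamma] gives the inequality in the support ([pareto_bound_ge1],
    [pareto_bound_lt1], [pareto_bound_cross]).  To the left of the support
    [G = 1] and [`|1 - c| <= delta] suffices; to the right [G = 0], and the
    inequality is inherited from the support because the Pareto survival
    function decreases. *)

Local Open Scope classical_set_scope.
Local Open Scope complex_scope.
Local Open Scope ring_scope.

(** * Comparing increments of functions *)

(** Both [g - f] and [g + f] have a nonnegative derivative.  Comparing
    increments, not difference quotients, lets the bound be measured against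
    any nondecreasing [g]: below, the primitive of a nonnegative density and a
    multiple of [x `^ gamma]. *)
Lemma ler_dist_of_derive (R : realType) (f g df dg : R -> R) (x y : R) :
  x <= y ->
  (forall z, z \in `[x, y] -> is_derive z 1 f (df z)) ->
  (forall z, z \in `[x, y] -> is_derive z 1 g (dg z)) ->
  (forall z, z \in `[x, y] -> `|df z| <= dg z) ->
  `|f y - f x| <= g y - g x.
Proof.
move=> xy fD gD fg.
have yx0 : 0 <= y - x by rewrite subr_ge0.
have increase (h dh : R -> R) :
    (forall z, z \in `[x, y] -> is_derive z 1 h (dh z)) ->
    (forall z, z \in `[x, y] -> 0 <= dh z) -> 0 <= h y - h x.
  move=> hD dh0.
  have hC : {within `[x, y], continuous h}.
    by apply: derivable_within_continuous => z /hD [].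
  have hDo z : z \in `]x, y[ -> is_derive z 1 h (dh z).
    by move=> /subset_itv_oo_cc; exact: hD.
  have [c cxy hE] := @MVT_segment R h dh x y xy hDo hC.
  by rewrite hE mulr_ge0// dh0.
have inc1 := increase (g \- f) (fun z => dg z - df z).
have inc2 := increase (g \+ f) (fun z => dg z + df z).
rewrite ler_norml; apply/andP; split.
  rewrite -subr_ge0.
  have -> : f y - f x - - (g y - g x) = (g \+ f) y - (g \+ f) x.
    by rewrite /=; ring.
  apply: inc2 => z zxy.
    by apply: is_deriveD; [exact: gD|exact: fD].
  by have := fg z zxy; rewrite ler_norml => /andP[]; lra.
rewrite -subr_ge0.
have -> : g y - g x - (f y - f x) = (g \- f) y - (g \- f) x.
  by rewrite /=; ring.
apply: inc1 => z zxy.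
  by apply: is_deriveB; [exact: gD|exact: fD].
by have := fg z zxy; rewrite ler_norml => /andP[]; lra.
Qed.

(** * The primitive from minus infinity of an integrable function *)

Section primitive.
Context {R : realType}.
Variable f : R -> R.
Local Notation mu := (@lebesgue_measure R).
Hypothesis intf : mu.-integrable setT (EFin \o f).

Definition primitive (x : R) : R := \int[mu]_(t in `]-oo, x]) f t.

Lemma primitiveB (x y : R) : x <= y ->
  primitive y - primitive x = \int[mu]_(t in `]x, y]) f t.
Proof.
move=> xy; rewrite /primitive; apply: Rintegral_itvB.
- exact: integrableS intf.
- by rewrite bnd_simp.
- by rewrite bnd_simp.
Qed.

Lemma is_derive_primitive (x : R) :
  {for x, continuous f} -> is_derive x 1 primitive (f x).
Proof.
move=> cf; have xx1 : x < x + 1 by rewrite ltrDl.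
have intx : mu.-integrable `]-oo, x + 1] (EFin \o f) by exact: integrableS intf.
have [dF F'] := continuous_FTC1 xx1 intx (ltNyr x) cf.
by apply: DeriveDef => //; rewrite -derive1E.
Qed.

(** Absolute continuity of the integral. *)
Lemma primitive_unif_continuous (e : R) : 0 < e ->
  exists2 d : R, 0 < d & forall x y, x <= y -> y < x + d ->
    `|primitive y - primitive x| < e.
Proof.
move=> e0; have [d [d0 small]] := integral_normr_continuous intf e0.
exists d => // x y xy yxd; rewrite primitiveB//.
apply: le_lt_trans (small `]x, y]%classic _ _) => //.
  by apply: le_normr_Rintegral => //; exact: integrableS intf.
have /= muE := lebesgue_measure_itv `]x, y].
apply: le_lt_trans (_ : (y - x)%:E < _)%E.
  rewrite le_eqVlt; apply/orP; left; apply/eqP; rewrite [LHS]muE lte_fin.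
  by case: ltgtP xy => // -> _; rewrite subrr.
by rewrite lte_fin ltrBlDl.
Qed.

Lemma primitive_cvg_right (x : R) : primitive y @[y --> x^'+] --> primitive x.
Proof.
apply/cvgrPdist_lt => e e0; have [d d0 small] := primitive_unif_continuous e0.
near=> y; rewrite distrC; apply: small.
  by near: y; exact: nbhs_right_ge.
by near: y; apply: nbhs_right_lt; rewrite ltrDl.
Unshelve. all: end_near. Qed.

Lemma primitive_cvg_left (x : R) : primitive y @[y --> x^'-] --> primitive x.
Proof.
apply/cvgrPdist_lt => e e0; have [d d0 small] := primitive_unif_continuous e0.
near=> y; apply: small.
  by near: y; exact: nbhs_left_le.
by rewrite -ltrBlDr; near: y; apply: nbhs_left_gt; rewrite ltrBlDr ltrDl.
Unshelve. all: end_near. Qed.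

Hypothesis f_ge0 : forall x, 0 <= f x.

Lemma primitive_ndecr (x y : R) : x <= y -> primitive x <= primitive y.
Proof.
by move=> xy; rewrite -subr_ge0 primitiveB//; apply: Rintegral_ge0.
Qed.

Lemma EFin_primitive (x : R) :
  (primitive x)%:E = (\int[mu]_(t in `]-oo, x]) (f t)%:E)%E.
Proof.
rewrite /primitive /Rintegral fineK//; apply: integrable_fin_num => //.
exact: integrableS intf.
Qed.

Lemma primitive_le (x : R) : primitive x <= \int[mu]_t f t.
Proof.
rewrite -lee_fin EFin_primitive /Rintegral fineK; last first.
  exact: integrable_fin_num.
apply: ge0_subset_integral => //.
- exact: measurable_int intf.
- by move=> t _; rewrite lee_fin.
Qed.

(** Monotone convergence along the rays ending at the integers, extended to all
    reals by monotonicity of the primitive. *)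
Lemma primitive_cvgy : primitive y @[y --> +oo] --> \int[mu]_t f t.
Proof.
pose D (n : nat) : set R := `]-oo, n%:R]%classic.
have DT : \bigcup_n D n = setT.
  apply/seteqP; split=> // x _; exists (Num.truncn x).+1 => //.
  by rewrite /D/= in_itv/= ltW// truncnS_gt.
have cvgD : (primitive n%:R)%:E @[n --> \oo] --> (\int[mu]_t f t)%:E.
  have -> : (\int[mu]_t f t)%:E = (\int[mu]_(t in \bigcup_n D n) (f t)%:E)%E.
    by rewrite DT /Rintegral fineK//; exact: integrable_fin_num.
  under eq_cvg do rewrite EFin_primitive.
  apply: ge0_nondecreasing_set_cvg_integral.
  - move=> m n mn; apply/subsetPset => x; rewrite /D/= !in_itv/= => /le_trans.
    by apply; rewrite ler_nat.
  - by move=> n; exact: measurable_itv.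
  - by move=> i; apply: measurable_funS (measurable_int _ intf).
  - by move=> i x _; rewrite lee_fin.
move/fine_cvgP : cvgD => [_ /= cvgD].
apply/cvgrPdist_lt => e e0.
move/cvgrPdist_lt : cvgD => /(_ e e0) [n _ /(_ n (leqnn n))/= close].
near=> y.
have ny : n%:R <= y by near: y; apply: nbhs_pinfty_ge; rewrite num_real.
have := primitive_ndecr ny; have py := primitive_le y.
move: close; rewrite !ger0_norm ?subr_ge0 ?primitive_le// => close pny.
by apply: le_lt_trans close; rewrite lerB.
Unshelve. all: end_near. Qed.

End primitive.

(** * The open interval with a possibly infinite right end *)

Section eopen_itv_theory.
Context {R : realType}.
Implicit Types (A : R) (B : \bar R).

Lemma eopen_itv_convex A B (x y z : R) :
  eopen_itv A B x -> eopen_itv A B y -> z \in `[x, y] -> eopen_itv A B z.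
Proof.
move=> [Ax _] [_ yB]; rewrite in_itv/= => /andP[xz zy].
by split; [exact: lt_le_trans xz|apply: le_lt_trans yB; rewrite lee_fin].
Qed.

Lemma open_eopen_itv A B : open (eopen_itv A B).
Proof.
have -> : eopen_itv A B = `]A, +oo[ `&` [set x | (x%:E < B)%E].
  by apply/seteqP; split=> x; rewrite /= in_itv/= andbT.
apply: openI; first exact: interval_open.
case: B => [b| |].
- have -> : [set x : R | (x%:E < b%:E)%E] = `]-oo, b[%classic.
    by apply/seteqP; split=> x; rewrite /= in_itv/= lte_fin.
  exact: interval_open.
- have -> : [set x : R | (x%:E < +oo)%E] = setT.
    by apply/seteqP; split=> x //= _; rewrite ltry.
  exact: openT.
- have -> : [set x : R | (x%:E < -oo)%E] = set0 by apply/seteqP; split=> x.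
  exact: open0.
Qed.

Lemma near_right_eopen_itv A B : (A%:E < B)%E ->
  \forall x \near A^'+, eopen_itv A B x.
Proof.
case: B => [b| |//] AB; near=> x; split.
- by near: x; exact: nbhs_right_gt.
- by rewrite lte_fin; near: x; apply: nbhs_right_lt; rewrite -lte_fin.
- by near: x; exact: nbhs_right_gt.
- exact: ltry.
Unshelve. all: end_near. Qed.

Lemma eat_left_proper A B : (A%:E < B)%E -> ProperFilter (eat_left B).
Proof. by case: B => [b| |] //= _; exact: _. Qed.

Lemma near_eat_left_gt B (x : R) : (x%:E < B)%E ->
  \forall y \near eat_left B, x < y.
Proof.
case: B => [b| |] //= xB; first by apply: nbhs_left_gt; rewrite -lte_fin.
by apply: nbhs_pinfty_gt; rewrite num_real.
Qed.

Lemma near_eat_left_lt B : \forall y \near eat_left B, (y%:E < B)%E.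
Proof.
case: B => [b| |] //=.
- by near=> y; rewrite lte_fin; near: y; exact: nbhs_left_lt.
- by near=> y; rewrite ltry.
Unshelve. all: end_near. Qed.

Lemma near_eat_left_eopen_itv A B : (A%:E < B)%E ->
  \forall x \near eat_left B, eopen_itv A B x.
Proof.
move=> AB; have ? := eat_left_proper AB.
by apply: filterI; [exact: near_eat_left_gt|exact: near_eat_left_lt].
Qed.

End eopen_itv_theory.

(** * Arithmetic of the weighted survival function *)

(** In these lemmas [p] and [q] stand for [x `^ gamma] and [A `^ gamma], [g] for
    the survival function at [x], [c] for the boundary term and [d] for the
    integrated Stein discrepancy. *)
Section algebra.
Context {R : realFieldType}.
Variables (p g q c d : R).
Hypotheses (q_gt0 : 0 < q) (qp : q <= p) (c_ge0 : 0 <= c) (d_ge0 : 0 <= d).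

(** Mass starting to the right of 1.  The error [q - 1] made at the start is at
    most [(q - 1) * (c + d)], because [1 <= c + d]: its [c] part gives the
    boundary term, and its [d] part fits into the room left by
    [d * (p - q) <= d * p]. *)
Lemma pareto_bound_ge1 : 1 <= q -> `|1 - c| <= d ->
  `|p * g - q| <= d * (p - q) -> `|g - p^-1| <= d + c * (1 - q^-1).
Proof.
move=> q1 cd h; have p_gt0 : 0 < p by exact: lt_le_trans qp.
have cd1 : 1 <= c + d by move: cd; rewrite ler_norml => /andP[]; lra.
rewrite -(ler_pM2l p_gt0) -[X in X * `|_|](gtr0_norm p_gt0) -normrM.
rewrite mulrBr divff ?gt_eqF//.
have h2 : `|p * g - 1| <= d * (p - q) + (q - 1) * (c + d).
  rewrite (_ : p * g - 1 = (p * g - q) + (q - 1)); last by ring.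
  apply: (le_trans (ler_normD _ _)); apply: lerD => //.
  by rewrite ger0_norm ?subr_ge0// ler_peMr// subr_ge0.
apply: le_trans h2 _.
have : (q - 1) * c <= p * (c * (1 - q^-1)).
  have -> : (q - 1) * c = q * (c * (1 - q^-1)) by field; rewrite gt_eqF.
  rewrite ler_wpM2r// mulr_ge0// subr_ge0 invf_le1//.
by move: (d_ge0); lra.
Qed.

(** Left of 1 the target is 1, and [p * g - p] is [- c * (p - q)] up to the
    error; dividing by [p], the factor [1 - q / p] is at most [1 - q]. *)
Lemma pareto_bound_lt1 : p <= 1 ->
  `|p * g - q - (1 - c) * (p - q)| <= d * (p - q) ->
  `|g - 1| <= d + c * (1 - q).
Proof.
move=> p1 h; have p_gt0 : 0 < p by exact: lt_le_trans qp.
rewrite -(ler_pM2l p_gt0) -[X in X * `|_|](gtr0_norm p_gt0) -normrM.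
have h2 : `|p * (g - 1)| <= d * (p - q) + c * (p - q).
  have -> : p * (g - 1) = (p * g - q - (1 - c) * (p - q)) - c * (p - q) by ring.
  apply: (le_trans (ler_normB _ _)); apply: lerD => //.
  by rewrite ger0_norm// mulr_ge0// subr_ge0.
apply: le_trans h2 _.
have /(ler_wpM2l c_ge0) : p - q <= p * (1 - q).
  by rewrite mulrBr mulr1 lerB// ler_piMl// ltW.
have dq_ge0 : 0 <= d * q by rewrite mulr_ge0// ltW.
lra.
Qed.

(** Mass starting to the left of 1 but evaluated to the right of it: the centred
    estimate is used up to the point 1, where the survival function is [g1], and
    the uncentred one from there on. *)
Lemma pareto_bound_cross (g1 : R) : q <= 1 -> 1 <= p ->
  `|g1 - q - (1 - c) * (1 - q)| <= d * (1 - q) ->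
  `|p * g - g1| <= d * (p - 1) ->
  `|g - p^-1| <= d + c * (1 - q).
Proof.
move=> q1 p1 h1 h; have p_gt0 : 0 < p by exact: lt_le_trans qp.
rewrite -(ler_pM2l p_gt0) -[X in X * `|_|](gtr0_norm p_gt0) -normrM.
rewrite mulrBr divff ?gt_eqF//.
have h2 : `|p * g - 1| <= d * (p - 1) + d * (1 - q) + c * (1 - q).
  have -> : p * g - 1 =
      (p * g - g1) + (g1 - q - (1 - c) * (1 - q)) - c * (1 - q) by ring.
  apply: (le_trans (ler_normB _ _)); apply: lerD; last first.
    by rewrite ger0_norm// mulr_ge0// subr_ge0.
  by apply: (le_trans (ler_normD _ _)); apply: lerD.
apply: le_trans h2 _.
have : c * (1 - q) <= p * (c * (1 - q)).
  by rewrite ler_peMl// mulr_ge0// subr_ge0.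
have dq_ge0 : 0 <= d * q by rewrite mulr_ge0// ltW.
lra.
Qed.

End algebra.

(** * The Pareto distribution function *)

Section pareto.
Context {R : realType}.
Variable gamma : R.
Hypothesis gamma_gt0 : 0 < gamma.

Local Notation p x := (x `^ gamma).

Lemma powR_continuous (x : R) : 0 < x -> {for x, continuous (fun t : R => p t)}.
Proof.
move=> x0; have [+ _] := is_derive1_powR gamma x0.
by move=> /derivable1_diffP; exact: differentiable_continuous.
Qed.

Lemma one_powR : p (1 : R) = 1.
Proof. by rewrite powR1. Qed.

Lemma powR_ge1 (x : R) : 1 <= x -> 1 <= p x.
Proof.
move=> x1; have x0 := lt_le_trans ltr01 x1.
by rewrite -[leLHS]one_powR ge0_ler_powR ?nnegrE ?(ltW x0) ?(ltW gamma_gt0).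
Qed.

Lemma powR_le1 (x : R) : 0 <= x -> x <= 1 -> p x <= 1.
Proof.
by move=> x0 x1; rewrite -[leRHS]one_powR ge0_ler_powR ?nnegrE ?(ltW gamma_gt0).
Qed.

Lemma Psi_lt1 (x : R) : x < 1 -> Psi gamma x = 0.
Proof.
move=> x1; rewrite /Psi indicE memNset ?mulr0//= in_itv/= andbT.
by rewrite leNgt x1.
Qed.

Lemma Psi_ge1 (x : R) : 1 <= x -> Psi gamma x = 1 - (p x)^-1.
Proof.
by move=> x1; rewrite /Psi indicE mem_set ?mulr1 ?powRN//= in_itv/= andbT.
Qed.

Lemma Psi_ndecr (x y : R) : x <= y -> Psi gamma x <= Psi gamma y.
Proof.
move=> xy; have [y1|y1] := ltP y 1.
  by rewrite !Psi_lt1// (le_lt_trans xy).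
have y0 := lt_le_trans ltr01 y1.
rewrite [leRHS]Psi_ge1//; have [x1|x1] := ltP x 1.
  by rewrite Psi_lt1// subr_ge0 invf_le1 ?powR_gt0// powR_ge1.
have x0 := lt_le_trans ltr01 x1.
rewrite Psi_ge1// lerB// lef_pV2 ?posrE ?powR_gt0//.
by rewrite ge0_ler_powR ?nnegrE ?(ltW x0) ?(ltW y0) ?(ltW gamma_gt0).
Qed.

Lemma Psi_le1 (x : R) : Psi gamma x <= 1.
Proof.
have [x1|x1] := ltP x 1; first by rewrite Psi_lt1.
by rewrite Psi_ge1// gerBl invr_ge0 powR_ge0.
Qed.

End pareto.

(** * The Stein equation of the density *)

Section density.
Context {R : realType}.
Local Notation mu := (@lebesgue_measure R).
Variables (gamma : R) (u : R -> R) (A : R) (B : \bar R) (l : R).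
Hypothesis gamma_gt0 : 0 < gamma.
Hypothesis mu_u : measurable_fun setT u.
Hypothesis u_ge0 : forall x, 0 <= u x.
Hypothesis u_int1 : (\int[mu]_x (u x)%:E = 1)%E.
Hypothesis A_gt0 : 0 < A.
Hypothesis AB : (A%:E < B)%E.
Hypothesis supp_u : supp u = eclosed_itv A B.
Hypothesis l_ge0 : 0 <= l.
Hypothesis u_cvgA : t * u t @[t --> A^'+] --> l.
Hypothesis u_cvgB : t * u t @[t --> eat_left B] --> (0 : R).
Hypothesis u_gt0 : forall t, eopen_itv A B t -> 0 < u t.
Hypothesis u_derivable : forall t, eopen_itv A B t -> derivable u t 1.
Hypothesis score_bounded :
  exists K : R, forall t, eopen_itv A B t -> `|t * score u t| <= K.
Hypothesis score_continuous :
  {within eopen_itv A B, continuous (fun t => t * score u t)}.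

Local Notation stein := (stein_discrepancy gamma u A B).
Local Notation F := (primitive u).

Lemma integrable_density : mu.-integrable setT (EFin \o u).
Proof.
apply/integrableP; split; first exact/measurable_EFinP.
under eq_integral do rewrite /= ger0_norm//.
by rewrite u_int1 ltry.
Qed.

Let intu := integrable_density.

Lemma density_int1 : \int[mu]_x u x = 1.
Proof. by rewrite /Rintegral u_int1. Qed.

Lemma density_eq0 (t : R) : ~ eclosed_itv A B t -> u t = 0.
Proof.
move=> tAB; apply/eqP; rewrite eq_le u_ge0 andbT leNgt; apply/negP => ut.
by apply: tAB; rewrite -supp_u; apply: subset_closure.
Qed.

Lemma cdf_eq0 (x : R) : x <= A -> F x = 0.
Proof.
move=> xA.
(* [u A] may be nonzero, so the endpoint is dropped first. *)
rewrite /primitive -Rintegral_itv_bndo_bndc; last first.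
  exact: integrableS intu.
rewrite (@eq_Rintegral _ _ _ mu _ (cst 0)).
  by rewrite Rintegral_cst// mul0r.
move=> t; rewrite inE/= in_itv/= => tx; apply: density_eq0 => -[At _].
by move: (le_lt_trans At (lt_le_trans tx xA)); rewrite ltxx.
Qed.

Lemma cdf_eq1 (x : R) : (B <= x%:E)%E -> F x = 1.
Proof.
move=> Bx; rewrite -density_int1 /primitive Rintegral_mkcond.
congr (Rintegral _ _ _); apply/funext => t; rewrite patchE.
case: ifPn => //; rewrite notin_setE/= in_itv/= => /negP; rewrite -ltNge => xt.
apply/esym/density_eq0 => -[_ tB].
by move: (le_trans tB Bx); rewrite lee_fin leNgt xt.
Qed.

Lemma cdf_cvg_eat_left : F x @[x --> eat_left B] --> (1 : R).
Proof.
case: B AB (@cdf_eq1) => [b| |]//= Ab F1.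
  by rewrite -(F1 b)//; exact: primitive_cvg_left.
by rewrite -density_int1; exact: primitive_cvgy.
Qed.

Lemma scoreE (t : R) : eopen_itv A B t -> score u t = derive1 u t / u t.
Proof.
move=> tAB; rewrite /score derive1E.
have du : is_derive t 1 u (derive1 u t).
  by apply: DeriveDef; [exact: u_derivable|rewrite -derive1E].
have dln := is_derive1_ln (u_gt0 tAB).
have dlnu : is_derive t 1 (@ln R \o u) ((u t)^-1 * derive1 u t).
  exact: is_derive1_comp.
by rewrite (_ : (fun t => ln (u t)) = @ln R \o u)// derive_val mulrC.
Qed.

(** The expression [u + gamma^-1 * (t * u)'], which vanishes identically for the
    Pareto density [gamma * t `^ (- gamma - 1)]. *)
Definition drift (t : R) : R := u t + gamma^-1 * (u t + t * derive1 u t).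

Lemma norm_drift (t : R) : eopen_itv A B t -> `|drift t| = stein t * u t.
Proof.
move=> tAB; have ut := u_gt0 tAB.
rewrite /stein_discrepancy patchE mem_set// -[X in _ * X]gtr0_norm// -normrM.
congr (`|_|); rewrite /drift scoreE//; field.
by rewrite !gt_eqF.
Qed.

(** A primitive of [- drift]; the additive constant makes it vanish at the right
    end of the support. *)
Definition stein_potential (x : R) : R := 1 - F x - gamma^-1 * (x * u x).

Lemma density_continuous (t : R) : eopen_itv A B t -> {for t, continuous u}.
Proof.
by move=> /u_derivable /derivable1_diffP; exact: differentiable_continuous.
Qed.

Lemma is_derive_stein_potential (t : R) : eopen_itv A B t ->
  is_derive t 1 stein_potential (- drift t).
Proof.
move=> tAB.
have du : is_derive t 1 u (derive1 u t).
  by apply: DeriveDef; [exact: u_derivable|rewrite -derive1E].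
have dF := is_derive_primitive intu (density_continuous tAB).
rewrite /stein_potential /drift; apply: is_derive_eq.
rewrite /GRing.scale/=; ring.
Qed.

(** This makes the Stein discrepancy of the operator an integral against [u];
    outside the support the extension by 0 keeps it bounded. *)
Lemma stein_bounded_borel : bounded_borel stein.
Proof.
split.
  have mI : measurable (eopen_itv A B : set (measurableTypeR R)).
    by apply: open_measurable; exact: open_eopen_itv.
  apply/(measurable_restrictT _ mI).
  apply: measurableT_comp => //.
  apply: measurable_funD => //; apply: measurable_funM => //.
  apply: measurable_funD => //.
  exact: subspace_continuous_measurable_fun.
have [K Kb] := score_bounded; exists (1 + gamma^-1 * (1 + `|K|)) => x.
have g0 : 0 <= gamma^-1 by rewrite invr_ge0 ltW.
rewrite /stein_discrepancy patchE; case: ifPn => [/set_mem xAB|_]; last first.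
  by rewrite /point/= normr0 addr_ge0// mulr_ge0// addr_ge0.
rewrite normr_id; apply: (le_trans (ler_normD _ _)); rewrite normr1 lerD2l.
rewrite normrM (ger0_norm g0) ler_wpM2l//.
apply: (le_trans (ler_normD _ _)); rewrite normr1 lerD2l.
exact: le_trans (Kb _ xAB) (ler_norm _).
Qed.

Lemma stein_ge0 (x : R) : 0 <= stein x.
Proof. by rewrite /stein_discrepancy patchE; case: ifPn. Qed.

Lemma integrable_stein : mu.-integrable setT (EFin \o (fun t => stein t * u t)).
Proof.
have [ms [K Ks]] := stein_bounded_borel.
apply: (@integrableMr _ _ _ mu _ measurableT stein (EFin \o u)) => //.
exists K; split; first exact: num_real.
by move=> k Kk x _; apply: le_trans (Ks x) (ltW Kk).
Qed.

Lemma stein_continuous (t : R) : eopen_itv A B t ->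
  {for t, continuous (fun t => stein t * u t)}.
Proof.
move=> tAB; apply: cvgM; last exact: density_continuous.
have oI := @open_eopen_itv _ A B.
have near_stein :
    \forall z \near t, `|1 + gamma^-1 * (1 + z * score u z)| = stein z.
  have : \forall z \near t, eopen_itv A B z by exact: open_nbhs_nbhs.
  by apply: filterS => z zAB; rewrite /stein_discrepancy patchE mem_set.
apply: cvg_trans.
  apply: near_eq_cvg; exact: near_stein.
rewrite -(nbhs_singleton near_stein).
have sC : {for t, continuous (fun z : R => z * score u z)}.
  move: score_continuous; rewrite continuous_open_subspace// => /(_ t).
  by apply; rewrite inE.
apply: (@cvg_norm _ R^o); apply: cvgD; first exact: cvg_cst.
apply: cvgM; first exact: cvg_cst.
by apply: cvgD; [exact: cvg_cst|exact: sC].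
Qed.

Local Notation delta := (\int[mu]_x (stein x * u x)).

Lemma delta_ge0 : 0 <= delta.
Proof. by apply: Rintegral_ge0 => x _; rewrite mulr_ge0// stein_ge0. Qed.

(** The drift is the derivative of the potential up to sign, and its absolute
    value integrates to [delta]. *)
Lemma stein_potential_osc (x y : R) : eopen_itv A B x -> eopen_itv A B y ->
  x <= y -> `|stein_potential y - stein_potential x| <= delta.
Proof.
move=> xAB yAB xy; pose P := primitive (fun t => stein t * u t).
have su_ge0 t : 0 <= stein t * u t by rewrite mulr_ge0// stein_ge0.
have in_AB z : z \in `[x, y] -> eopen_itv A B z by exact: eopen_itv_convex.
apply: (@le_trans _ _ (P y - P x)).
  apply: (@ler_dist_of_derive _ _ _ (fun t => - drift t)
    (fun t => stein t * u t)) => //.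
  - by move=> z /in_AB; exact: is_derive_stein_potential.
  - move=> z /in_AB zAB.
    exact: (is_derive_primitive integrable_stein (stein_continuous zAB)).
  - by move=> z /in_AB zAB; rewrite normrN norm_drift.
apply: (@le_trans _ _ (P y)); last exact: primitive_le integrable_stein _ _.
by rewrite lerBlDr lerDl /P /primitive Rintegral_ge0.
Qed.

Local Notation c := (gamma^-1 * l).

Lemma stein_potential_cvgB : stein_potential x @[x --> eat_left B] --> (0 : R).
Proof.
have ? := eat_left_proper AB.
rewrite [X in _ --> X](_ : _ = 1 - 1 - gamma^-1 * 0); last first.
  by rewrite subrr mulr0 subr0.
apply: cvgB; first by apply: cvgB; [exact: cvg_cst|exact: cdf_cvg_eat_left].
by apply: cvgM; [exact: cvg_cst|exact: u_cvgB].
Qed.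

Lemma stein_potential_cvgA : stein_potential x @[x --> A^'+] --> 1 - c.
Proof.
rewrite [X in _ --> X](_ : _ = 1 - F A - c); last by rewrite cdf_eq0// subr0.
apply: cvgB; first by apply: cvgB; [exact: cvg_cst|exact: primitive_cvg_right].
by apply: cvgM; [exact: cvg_cst|exact: u_cvgA].
Qed.

(** Letting the second point of the oscillation estimate tend to [B], where the
    potential vanishes because [t * u t] does. *)
Lemma stein_potential_le (x : R) : eopen_itv A B x ->
  `|stein_potential x| <= delta.
Proof.
move=> xAB; have ? := eat_left_proper AB; rewrite -normrN -sub0r.
have cv : `|stein_potential y - stein_potential x| @[y --> eat_left B] -->
    `|0 - stein_potential x|.
  apply: (@cvg_norm _ R^o).
  by apply: cvgB; [exact: stein_potential_cvgB|exact: cvg_cst].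
apply: ler_cvg_to cv (cvg_cst delta) _.
have nAB := near_eat_left_eopen_itv AB.
have ngt := near_eat_left_gt xAB.2.
near=> y; apply: stein_potential_osc => //; first by near: y.
by apply: ltW; near: y.
Unshelve. all: end_near. Qed.

(** Letting the second point tend to [A] instead, where the potential is
    [1 - c]. *)
Lemma stein_potential_centered_le (x : R) : eopen_itv A B x ->
  `|stein_potential x - (1 - c)| <= delta.
Proof.
move=> xAB.
have cv : `|stein_potential x - stein_potential y| @[y --> A^'+] -->
    `|stein_potential x - (1 - c)|.
  apply: (@cvg_norm _ R^o).
  by apply: cvgB; [exact: cvg_cst|exact: stein_potential_cvgA].
apply: ler_cvg_to cv (cvg_cst delta) _.
have nAB := near_right_eopen_itv AB.
near=> y; apply: stein_potential_osc => //; first by near: y.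
by near: y; apply: nbhs_right_le; exact: xAB.1.
Unshelve. all: end_near. Qed.

Lemma stein_potential_start_le : `|1 - c| <= delta.
Proof.
have cv : `|stein_potential y| @[y --> A^'+] --> `|1 - c|.
  by apply: (@cvg_norm _ R^o); exact: stein_potential_cvgA.
apply: ler_cvg_to cv (cvg_cst delta) _.
have nAB := near_right_eopen_itv AB.
by near=> y; apply: stein_potential_le; near: y.
Unshelve. all: end_near. Qed.

Local Notation G x := (1 - F x).
Local Notation p x := (x `^ gamma).

(** The function [t `^ gamma * (1 - F t)] has derivative
    [gamma * t `^ (gamma - 1)] times the Stein potential, so its increments are
    those of [t `^ gamma] times a value within [delta] of [k].  It serves for
    [k = 0] and for [k = 1 - c]. *)
Lemma weighted_survival_dist (k : R) (x y : R) :
  (forall z, eopen_itv A B z -> `|stein_potential z - k| <= delta) ->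
  eopen_itv A B x -> eopen_itv A B y -> x <= y ->
  `|p y * G y - p x * G x - k * (p y - p x)| <= delta * (p y - p x).
Proof.
move=> Vk xAB yAB xy.
have in_AB z : z \in `[x, y] -> eopen_itv A B z by exact: eopen_itv_convex.
rewrite (_ : _ - _ - _ = (p y * G y - k * p y) - (p x * G x - k * p x));
  last by ring.
rewrite [leRHS]mulrBr.
have dp z : z \in `[x, y] ->
    is_derive z 1 (fun t => p t) (gamma * z `^ (gamma - 1)).
  by move=> /in_AB [Az _]; apply: is_derive1_powR; exact: lt_trans Az.
apply: (@ler_dist_of_derive _
  (fun t => p t * G t - k * p t) (fun t => delta * p t)
  (fun t => gamma * t `^ (gamma - 1) * (stein_potential t - k))
  (fun t => delta * (gamma * t `^ (gamma - 1)))) => // z zxy;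
  have zAB := in_AB z zxy.
- have dpz := dp z zxy.
  have dF := is_derive_primitive intu (density_continuous zAB).
  apply: is_derive_eq.
  have z0 : 0 < z := lt_trans A_gt0 zAB.1.
  have pE : p z = z * z `^ (gamma - 1).
    by rewrite -{2}(powRr1 (ltW z0)) -powRD ?subrKC// gt_eqF// implybT.
  rewrite /GRing.scale/= pE /stein_potential; field.
  by rewrite gt_eqF.
- have dpz := dp z zxy.
  apply: is_derive_eq; rewrite /GRing.scale/=; ring.
- have w0 : 0 <= gamma * z `^ (gamma - 1) by rewrite mulr_ge0 ?powR_ge0// ltW.
  by rewrite normrM (ger0_norm w0) mulrC ler_wpM2r// Vk.
Qed.

(** The limit of the previous estimate at the left end, where [F A = 0]. *)
Lemma weighted_survival_distA (k : R) (x : R) :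
  (forall z, eopen_itv A B z -> `|stein_potential z - k| <= delta) ->
  eopen_itv A B x ->
  `|p x * G x - p A - k * (p x - p A)| <= delta * (p x - p A).
Proof.
move=> Vk xAB.
have cp := cvg_at_right_filter (@powR_continuous _ gamma _ A_gt0).
have cpG : p y * G y @[y --> A^'+] --> p A.
  rewrite [X in _ --> X](_ : _ = p A * (1 - F A)); last first.
    by rewrite cdf_eq0// subr0 mulr1.
  apply: cvgM => //.
  by apply: cvgB; [exact: cvg_cst|exact: primitive_cvg_right].
have nAB := near_right_eopen_itv AB.
apply: (@ler_cvg_to _ A^'+ _ _
  (fun y => `|p x * G x - p y * G y - k * (p x - p y)|)
  (fun y => delta * (p x - p y))).
- apply: (@cvg_norm _ R^o); apply: cvgB.
    by apply: cvgB => //; exact: cvg_cst.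
  by apply: cvgM; [exact: cvg_cst|apply: cvgB => //; exact: cvg_cst].
- by apply: cvgM; [exact: cvg_cst|apply: cvgB => //; exact: cvg_cst].
- near=> y; apply: weighted_survival_dist => //; first by near: y.
  by near: y; apply: nbhs_right_le; exact: xAB.1.
Unshelve. all: end_near. Qed.

(** * The distance to the Pareto distribution function *)

Local Notation bound := (delta + c * (1 - (Num.min A A^-1) `^ gamma)).

Lemma c_ge0 : 0 <= c.
Proof. by rewrite mulr_ge0// invr_ge0 ltW. Qed.

Lemma boundE_ge1 : 1 <= A -> bound = delta + c * (1 - (p A)^-1).
Proof.
move=> A1; have -> : Num.min A A^-1 = A^-1.
  by apply/min_idPr; apply: (le_trans _ A1); rewrite invf_le1.
by rewrite -[A^-1]powR_inv1 ?(ltW A_gt0)// -powRrM mulN1r powRN.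
Qed.

Lemma boundE_lt1 : A < 1 -> bound = delta + c * (1 - p A).
Proof.
move=> A1; have -> // : Num.min A A^-1 = A.
by apply/min_idPl; apply: (le_trans (ltW A1)); rewrite invf_ge1// ltW.
Qed.

(** Up to [A] the gap is [Psi gamma], largest at [A].  If [A < 1] it vanishes;
    if [1 <= A], the arithmetic lemma applies at the starting point itself,
    with survival function 1. *)
Lemma dist_cdf_Psi_below_support (x : R) :
  x <= A -> `|F x - Psi gamma x| <= bound.
Proof.
move=> xA; rewrite cdf_eq0// sub0r normrN.
have Psi0 : 0 <= Psi gamma x.
  have [x1|x1] := ltP x 1; first by rewrite Psi_lt1.
  rewrite -(@Psi_lt1 _ gamma 0)//; apply: (Psi_ndecr gamma_gt0).
  exact: le_trans x1.
rewrite ger0_norm//; have [A1|A1] := leP 1 A.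
  rewrite boundE_ge1//; apply: (le_trans (Psi_ndecr gamma_gt0 xA)).
  rewrite Psi_ge1//.
  apply: (le_trans (ler_norm _)).
  apply: (@pareto_bound_ge1 _ (p A)) => //;
    rewrite ?powR_gt0 ?c_ge0 ?delta_ge0 ?(powR_ge1 gamma_gt0)//.
    exact: stein_potential_start_le.
  by rewrite mulr1 !subrr normr0 mulr0.
rewrite boundE_lt1// Psi_lt1 ?(le_lt_trans xA)//.
rewrite addr_ge0 ?delta_ge0// mulr_ge0 ?c_ge0// subr_ge0.
by rewrite (powR_le1 gamma_gt0)// ltW.
Qed.

Lemma dist_cdf_Psi_in_support (x : R) :
  eopen_itv A B x -> `|F x - Psi gamma x| <= bound.
Proof.
move=> xAB; have [Ax xB] := xAB; have x0 := lt_trans A_gt0 Ax.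
have pA0 : 0 < p A by exact: powR_gt0.
have pAx : p A <= p x.
  rewrite ge0_ler_powR ?nnegrE ?(ltW x0) ?(ltW A_gt0) ?(ltW gamma_gt0)//.
  exact: ltW.
have V0 z : eopen_itv A B z -> `|stein_potential z - 0| <= delta.
  by rewrite subr0; exact: stein_potential_le.
have V1 := stein_potential_centered_le.
have [A1|A1] := leP 1 A.
  have x1 : 1 <= x by rewrite (le_trans A1)// ltW.
  rewrite boundE_ge1// Psi_ge1// distrC.
  rewrite (_ : _ - _ = G x - (p x)^-1); last by ring.
  apply: (@pareto_bound_ge1 _ (p x)) => //;
    rewrite ?c_ge0 ?delta_ge0 ?(powR_ge1 gamma_gt0)//.
    exact: stein_potential_start_le.
  by have := weighted_survival_distA V0 xAB; rewrite mul0r subr0.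
rewrite boundE_lt1//; have [x1|x1] := ltP x 1.
  rewrite Psi_lt1// subr0 -normrN (_ : - F x = G x - 1); last by ring.
  apply: (@pareto_bound_lt1 _ (p x)) => //;
    rewrite ?c_ge0 ?delta_ge0 ?(powR_le1 gamma_gt0) ?(ltW x0) ?(ltW x1)//.
  exact: weighted_survival_distA.
have AB1 : eopen_itv A B 1.
  by split=> //; apply: le_lt_trans xB; rewrite lee_fin.
rewrite Psi_ge1// distrC (_ : _ - _ = G x - (p x)^-1); last by ring.
apply: (@pareto_bound_cross _ (p x) (G x) (p A) c delta _ _ _ _ (G 1)) => //;
  rewrite ?c_ge0 ?delta_ge0 ?(powR_ge1 gamma_gt0)//.
- by rewrite (powR_le1 gamma_gt0)// ltW.
- by have := weighted_survival_distA V1 AB1; rewrite one_powR mul1r.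
- have := weighted_survival_dist V0 AB1 xAB x1.
  by rewrite one_powR mul1r mul0r subr0.
Qed.

(** The gap [1 - Psi gamma] decreases, so the bound passes to the limit from
    inside the support. *)
Lemma dist_cdf_Psi_above_support (x : R) :
  (B <= x%:E)%E -> `|F x - Psi gamma x| <= bound.
Proof.
move=> Bx; have ? := eat_left_proper AB; rewrite cdf_eq1//.
rewrite ger0_norm ?subr_ge0 ?Psi_le1//.
have cv : 1 - F y + bound @[y --> eat_left B] --> 1 - 1 + bound.
  apply: cvgD; last exact: cvg_cst.
  by apply: cvgB; [exact: cvg_cst|exact: cdf_cvg_eat_left].
rewrite subrr add0r in cv; apply: ler_cvg_to (cvg_cst _) cv _.
have nAB := near_eat_left_eopen_itv AB.
near=> y; have yAB : eopen_itv A B y by near: y.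
have yx : y <= x by rewrite -lee_fin; apply: le_trans Bx; exact: ltW yAB.2.
have := Psi_ndecr gamma_gt0 yx; have := dist_cdf_Psi_in_support yAB.
by rewrite ler_norml => /andP[]; lra.
Unshelve. all: end_near. Qed.

Lemma dist_cdf_Psi (x : R) : `|F x - Psi gamma x| <= bound.
Proof.
have [xA|Ax] := leP x A; first exact: dist_cdf_Psi_below_support.
have [Bx|xB] := leP B x%:E; first exact: dist_cdf_Psi_above_support.
exact: dist_cdf_Psi_in_support.
Qed.

End density.

(** * The distribution of an affiliated operator with a density *)

Lemma bounded_borel_indic (R : realType) (E : set R) :
  measurable (E : set (measurableTypeR R)) -> bounded_borel (\1_E : R -> R).
Proof.
move=> mE; split; first exact: measurable_indic.
by exists 1 => x; rewrite indicE; case: (_ \in _); rewrite ?normr1 ?normr0.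
Qed.

Lemma spectral_df_density (R : realType) (H : completeNormedModType R[i])
    (ip : {dot H for (@Num.conj R[i])}) (tau : (H -> H) -> R[i])
    (W : set (H * H)) (u : R -> R) (x : R) :
  has_density ip tau W u -> spectral_df ip tau W x = primitive u x.
Proof.
move=> [_ _ _ tauE].
rewrite /spectral_df /spectral_projection tauE/=; last first.
  exact: bounded_borel_indic.
rewrite /primitive [RHS]Rintegral_mkcond; congr (Rintegral _ _ _).
apply/funext => t; rewrite patchE indicE.
by case: (t \in _); rewrite ?mul1r ?mul0r.
Qed.

Lemma cvg_at_right_div_id (R : realType) (u : R -> R) (A l : R) : 0 < A ->
  t * u t @[t --> A^'+] --> l -> u t @[t --> A^'+] --> A^-1 * l.
Proof.
move=> A0 ul.
have inv : t^-1 @[t --> A^'+] --> A^-1.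
  by apply: cvg_at_right_filter; apply: inv_continuous; rewrite gt_eqF.
apply: cvg_trans (cvgM inv ul); apply: near_eq_cvg.
by near=> t; rewrite /= mulKf// gt_eqF// (lt_trans A0)//.
Unshelve. all: end_near. Qed.

Theorem theorem4p2 (R : realType) (gamma : R)
  (H : completeNormedModType R[i]) (ip : {dot H for (@Num.conj R[i])})
  (M : set (H -> H)) (tau : (H -> H) -> R[i])
  (X : nat -> set (H * H)) (U : R -> R) (a b : nat -> R)
  (u : nat -> R -> R) (A : nat -> R) (B : nat -> \bar R)
  (gamma_gt0 : 0 < gamma)
  (hilbertH : hilbert_space ip)
  (spaceM : tracial_Wstar_probability_space ip M tau)
  (affX : forall i, affiliated ip M (X i))
  (freeX : freely_independent ip tau X)
  (dfX : forall i, spectral_df ip tau (X i) = U)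
  (a_gt0 : forall n, (1 <= n)%N -> 0 < a n)
  (cvgW : weakly_converges
     (fun n => spectral_df ip tau (normalized_max ip M X a b n)) (Psi gamma))
  (densW : forall n, (2 <= n)%N ->
     has_density ip tau (normalized_max ip M X a b n) (u n))
  (suppu : forall n, (2 <= n)%N ->
     [/\ 0 < A n, ((A n)%:E < B n)%E &
         supp (u n) = eclosed_itv (A n) (B n)])
  (limA : forall n, (2 <= n)%N ->
     exists2 l : R, 0 <= l & t * u n t @[t --> (A n)^'+] --> l)
  (limB : forall n, (2 <= n)%N ->
     t * u n t @[t --> eat_left (B n)] --> (0 : R))
  (* implicit in the definition of rho_n = (log u_n)' on (A_n, B_n) *)
  (u_gt0 : forall n, (2 <= n)%N ->
     forall t, eopen_itv (A n) (B n) t -> 0 < u n t)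
  (derivu : forall n, (2 <= n)%N ->
     forall t, eopen_itv (A n) (B n) t -> derivable (u n) t 1)
  (boundrho : forall n, (2 <= n)%N ->
     exists K : R, forall t, eopen_itv (A n) (B n) t ->
       `|t * score (u n) t| <= K)
  (contrho : forall n, (2 <= n)%N ->
     {within eopen_itv (A n) (B n), continuous (fun t => t * score (u n) t)}) :
  forall n, (2 <= n)%N ->
    (kolmogorov_dist
       (spectral_df ip tau (normalized_max ip M X a b n)) (Psi gamma) <=
     (complex.Re (tau (fcalc ip (normalized_max ip M X a b n)
                        (stein_discrepancy gamma (u n) (A n) (B n)))) +
      gamma^-1 * A n * (1 - (Num.min (A n) (A n)^-1) `^ gamma) *
        lim (u n t @[t --> (A n)^'+]))%:E)%E.
Proof.
move=> n n2; have dens := densW n n2.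
have [mu_u u_ge0 u_int1 tauE] := dens.
have [A_gt0 AB supp_u] := suppu n n2.
have [l l_ge0 u_cvgA] := limA n n2.
have bb := stein_bounded_borel gamma_gt0 (boundrho n n2) (contrho n n2).
rewrite tauE//= (cvg_lim _ (cvg_at_right_div_id A_gt0 u_cvgA))//.
apply: ge_ereal_sup => _ [x _ <-]; rewrite lee_fin (spectral_df_density _ dens).
have := dist_cdf_Psi gamma_gt0 mu_u u_ge0 u_int1 A_gt0 AB supp_u l_ge0
  u_cvgA (limB n n2) (u_gt0 n n2) (derivu n n2) (boundrho n n2)
  (contrho n n2) x.
move/le_trans; apply; rewrite lerD2l.
rewrite le_eqVlt; apply/orP; left; apply/eqP; field.
by rewrite !gt_eqF.
Qed.
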